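(* Let $F\subset\mathbb{R}^d$ be a compact convex set with $0\in\operatorname{int}(F)$, and let $m\ge2$, $1\le k\le m$. Then the optimal value function $v_k:\mathcal{K}^m\to\mathbb{R}$, $v_k(\Omega)=\min\{f_k(x,\Omega)\mid x\in\mathbb{R}^{dk}\}$, is $m\|F^\circ\|$-Lipschitz continuous on $\mathcal{K}^m$, i.e. $|v_k(\Omega)-v_k(\hat\Omega)|\le m\|F^\circ\|\,d_{\mathcal{K}^m}(\Omega,\hat\Omega)$ for all $\Omega,\hat\Omega\in\mathcal{K}^m$.
   Context: $\mathbb{R}^d$ ($d\ge1$) carries the Euclidean norm. $F^\circ=\{y\in\mathbb{R}^d\mid\langle y,x\rangle\le1\ \text{for all }x\in F\}$ and $\|F^\circ\|=\sup\{\|y\|\mid y\in F^\circ\}$. The minimal time function is $T_F(x,\Omega)=\inf\{t\ge 0\mid (x+tF)\cap\Omega\neq\emptyset\}$ for $x\in\mathbb{R}^d$ and nonempty $\Omega\subset\mathbb{R}^d$. $\mathcal{K}$ is the family of nonempty compact subsets of $\mathbb{R}^d$ with the Hausdorff metric $d_{\mathcal{K}}(A,B)=\max\{\sup_{a\in A}\inf_{b\in B}\|a-b\|,\ \sup_{b\in B}\inf_{a\in A}\|a-b\|\}$. On $\mathcal{K}^m$, with elements $\Omega=(\Omega^1,\dots,\Omega^m)$, $d_{\mathcal{K}^m}(\Omega,\hat\Omega)=\max_{1\le i\le m}d_{\mathcal{K}}(\Omega^i,\hat\Omega^i)$. For $x=(x^1,\dots,x^k)\in(\mathbb{R}^d)^k=\mathbb{R}^{dk}$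 and $\Omega\in\mathcal{K}^m$, $f_k(x,\Omega)=\sum_{i=1}^m\min_{1\le j\le k}T_F(x^j,\Omega^i)$ (the minimum over $x$ is attained). *)

(* Defs.v *)
From HB Require Import structures.
From mathcomp Require Import all_boot all_order all_algebra.
From mathcomp Require Import all_classical all_reals all_analysis.

Set Implicit Arguments.
Unset Strict Implicit.
Unset Printing Implicit Defensive.

Import Order.TTheory GRing.Theory Num.Theory.
Import numFieldNormedType.Exports.

Local Open Scope classical_set_scope.
Local Open Scope ring_scope.

Section MinimalTime.
Context {R : realType}.

(* Least element of A; the value is 0 when A has none. *)
Definition minimum (A : set R) : R := xget 0 (A `&` lbound A).

Section Space.
Context {d : nat}.
Implicit Types (x y : 'rV[R]_d) (F A B W : set 'rV[R]_d).

Definition dot x y : R := \sum_(i < d) x ord0 i * y ord0 i.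

(* The library norm on 'rV[R]_d is the max norm, not the Euclidean one; both
   induce its topology, hence the same compact sets and interiors. *)
Definition enorm x : R := Num.sqrt (dot x x).

Definition polar F : set 'rV[R]_d := [set y | forall x, F x -> dot y x <= 1].

(* Real-valued supremum: when F is a neighbourhood of 0, polar F is bounded. *)
Definition set_enorm A : R := sup [set enorm y | y in A].

(* x + t F *)
Definition dilate_at x (t : R) F : set 'rV[R]_d := [set x + t *: y | y in F].

(* Real-valued infimum: when F is a neighbourhood of 0 and W is nonempty, the
   set of admissible t is nonempty. *)
Definition min_time F x W : R :=
  inf [set t : R | 0 <= t /\ dilate_at x t F `&` W !=set0].

Definition nonempty_compact : set (set 'rV[R]_d) :=
  [set A | A !=set0 /\ compact A].

Definition excess A B : R :=
  sup [set inf [set enorm (a - b) | b in B] | a in A].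

Definition hausdorff_dist A B : R := Num.max (excess A B) (excess B A).

(* The neutral element 0 is harmless: Hausdorff distances are nonnegative. *)
Definition hausdorff_distn m (W V : 'I_m -> set 'rV[R]_d) : R :=
  \big[Num.max/0]_(i < m) hausdorff_dist (W i) (V i).

Definition location_cost F k m (x : 'I_k -> 'rV[R]_d)
    (W : 'I_m -> set 'rV[R]_d) : R :=
  \sum_(i < m) minimum (range (fun j : 'I_k => min_time F (x j) (W i))).

Definition optimal_value F k m (W : 'I_m -> set 'rV[R]_d) : R :=
  minimum (range (fun x : 'I_k -> 'rV[R]_d => location_cost F x W)).

End Space.
End MinimalTime.

(* Main.v *)
(** By the bipolar theorem, a vector u lies in sF as soon as s >= ||F^o|| |u|,
    and convexity gives tF + sF = (t+s)F.  Hence moving the target by at most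
    delta changes the minimal time by at most ||F^o|| delta, and the Lipschitz
    bound for v_k follows by evaluating the cost of W at a minimizer for V.
    A minimizer exists because f_k(x, W) is the minimum, over the assignments
    of the m targets to the k facilities, of a cost which splits into k
    independent problems in R^d, each continuous and coercive (or zero). *)
Require Import Defs.
From HB Require Import structures.
From mathcomp Require Import all_boot all_order all_algebra.
From mathcomp Require Import all_classical all_reals all_analysis.
From mathcomp Require Import ring lra.

Set Implicit Arguments.
Unset Strict Implicit.
Unset Printing Implicit Defensive.

Import Order.TTheory GRing.Theory Num.Theory.
Import numFieldNormedType.Exports.

Local Open Scope classical_set_scope.
Local Open Scope ring_scope.

(** * Euclidean inner product and norm, compared with the max norm of the library *)

Section EuclideanSpace.
Context {R : realType} {d : nat}.
Implicit Types (x y z u : 'rV[R]_d) (a : R) (A : set 'rV[R]_d).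

Lemma dotC x y : dot x y = dot y x.
Proof. by apply: eq_bigr => i _; rewrite mulrC. Qed.

Lemma dotDl x y z : dot (x + y) z = dot x z + dot y z.
Proof. by rewrite -big_split; apply: eq_bigr => i _; rewrite mxE mulrDl. Qed.

Lemma dotZl a x y : dot (a *: x) y = a * dot x y.
Proof. by rewrite mulr_sumr; apply: eq_bigr => i _; rewrite mxE mulrA. Qed.

Lemma dotNl x y : dot (- x) y = - dot x y.
Proof. by rewrite -scaleN1r dotZl mulN1r. Qed.

Lemma dotDr x y z : dot x (y + z) = dot x y + dot x z.
Proof. by rewrite dotC dotDl !(dotC x). Qed.

Lemma dotZr a x y : dot x (a *: y) = a * dot x y.
Proof. by rewrite dotC dotZl dotC. Qed.

Lemma dotNr x y : dot x (- y) = - dot x y.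
Proof. by rewrite dotC dotNl dotC. Qed.

Lemma dotBZ x y a :
  dot (x - a *: y) (x - a *: y) = dot x x - 2 * a * dot x y + a ^+ 2 * dot y y.
Proof. rewrite !(dotDl, dotDr, dotNl, dotNr, dotZl, dotZr) (dotC y x); ring. Qed.

Lemma dot_ge0 x : 0 <= dot x x.
Proof. by apply: sumr_ge0 => i _; exact: sqr_ge0. Qed.

Lemma enorm_ge0 x : 0 <= enorm x.
Proof. exact: sqrtr_ge0. Qed.

Lemma sqr_enorm x : enorm x ^+ 2 = dot x x.
Proof. by rewrite sqr_sqrtr ?dot_ge0. Qed.

Lemma enorm0 : enorm (0 : 'rV[R]_d) = 0.
Proof. by rewrite /enorm -(scale0r 0) dotZl mul0r sqrtr0. Qed.

Lemma enormN x : enorm (- x) = enorm x.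
Proof. by rewrite /enorm dotNl dotNr opprK. Qed.

Lemma coord_le_enorm x i : `|x ord0 i| <= enorm x.
Proof.
rewrite -sqrtr_sqr ler_sqrt ?dot_ge0// /dot (bigD1 i)//= expr2 lerDl.
by apply: sumr_ge0 => j _; exact: sqr_ge0.
Qed.

(** The max norm, when nonzero, is the absolute value of some coordinate. This carries Euclidean
    bounds over to the library norm. *)
Lemma mx_norm_le_enorm x : `|x| <= enorm x.
Proof.
rewrite -[`|x|]/(mx_norm x).
have [->|/mx_norm_neq0[[i j] /= ->]] := eqVneq (mx_norm x) 0.
  exact: enorm_ge0.
by rewrite ord1 coord_le_enorm.
Qed.

Lemma enorm_eq0 x : enorm x = 0 -> x = 0.
Proof.
by move=> x0; apply/eqP; rewrite -normr_le0 -x0; exact: mx_norm_le_enorm.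
Qed.

Lemma dot_gt0 x : x != 0 -> 0 < dot x x.
Proof.
move=> x0; rewrite lt_neqAle dot_ge0 andbT eq_sym -sqr_enorm sqrf_eq0.
by apply: contra x0 => /eqP/enorm_eq0 ->.
Qed.

(** For nonzero vectors, expand the nonnegative square of [enorm y *: x - enorm x *: y] and divide
    by twice the product of the norms. *)
Lemma cauchy_schwarz x y : dot x y <= enorm x * enorm y.
Proof.
have [/enorm_eq0 ->|x0] := eqVneq (enorm x) 0.
  by rewrite enorm0 mul0r -(scale0r 0) dotZl mul0r.
have [/enorm_eq0 ->|y0] := eqVneq (enorm y) 0.
  by rewrite enorm0 mulr0 -(scale0r 0) dotZr mul0r.
have xy0 : 0 < enorm x * enorm y.
  by rewrite mulr_gt0// lt_neqAle eq_sym ?x0 ?y0 enorm_ge0.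
have := dot_ge0 (enorm y *: x - enorm x *: y).
rewrite !(dotDl, dotDr, dotNl, dotNr, dotZl, dotZr) (dotC y x) -!sqr_enorm => h.
rewrite -(ler_pM2l xy0); nra.
Qed.

Lemma enorm_continuous : continuous (enorm : 'rV[R]_d -> R).
Proof.
move=> x; apply: (@continuous_comp _ _ _ (fun x => dot x x) Num.sqrt).
  apply: (@cvg_big _ _ _ 0 xpredT (@add_continuous R^o) _ (nbhs x)) => i _.
  by apply: cvgM; exact: coord_continuous.
exact: sqrt_continuous.
Qed.

Lemma enormB_continuous z : continuous (fun x => enorm (x - z)).
Proof.
move=> x; apply: (@continuous_comp _ _ _ (fun x => x - z) enorm).
  by apply: (@continuousB _ _ _ id (cst z)) => //; exact: cst_continuous.
exact: enorm_continuous.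
Qed.

(** A one-sided bound is enough: exchanging [x] and [y] gives the other side, and [g] is squeezed at
    [x]. *)
Lemma enorm_lipschitz_continuous (g : 'rV[R]_d -> R) (C : R) :
  (forall x y, g x <= g y + C * enorm (x - y)) -> continuous g.
Proof.
move=> gC x; have C0 (s : R) : (fun y => g x + s * enorm (y - x)) @ x --> g x.
  rewrite -[X in _ --> X]addr0 -(mulr0 s) -enorm0 -(subrr x).
  apply: (@cvgD _ _ _ (nbhs x) _ (cst (g x))).
    exact: cvg_cst.
  apply: (@cvgM _ _ (nbhs x) _ (cst s)); first exact: cvg_cst.
  exact: enormB_continuous.
apply: (squeeze_cvgr _ (C0 (- C)) (C0 C)); near=> y.
rewrite gC andbT mulNr lerBlDr -[enorm _]enormN opprB; exact: gC.
Unshelve. all: by end_near. Qed.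

Lemma compact_continuous_bounded A (g : 'rV[R]_d -> R) :
  A !=set0 -> compact A -> continuous g ->
  exists M, forall x, A x -> g x <= M.
Proof.
move=> A0 Ac gc; have [|c _ cP] := @EVT_max_rV R d g A A0 Ac.
  exact: continuous_subspaceT.
by exists (g c) => x Ax; apply: cP; rewrite inE.
Qed.

End EuclideanSpace.

Lemma mem_convex (R : realType) (d : nat) (F : set 'rV[R]_d) x y (l : R) :
  @convex_set R 'rV[R]_d F -> F x -> F y -> 0 <= l -> l <= 1 ->
  F (l *: x + (1 - l) *: y).
Proof.
move=> Fconvex Fx Fy l0 l1.
have := Fconvex x y (Itv01 l0 l1).
rewrite !inE => /(_ Fx Fy); exact.
Qed.

Lemma minimumE (R : realType) (A : set R) a :
  A a -> lbound A a -> minimum A = a.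
Proof.
move=> Aa lAa; rewrite /minimum.
have [] := @xgetPex _ (0 : R) (A `&` lbound A); first by exists a.
set b := xget _ _ => Ab lAb.
by apply/eqP; rewrite eq_le lAb// lAa.
Qed.

(** * Polar set, bipolar theorem and sums of dilates *)

Section Gauge.
Context {R : realType} {d : nat} (F : set 'rV[R]_d).
Hypotheses (Fcompact : compact F) (Fconvex : @convex_set R 'rV[R]_d F)
  (F0 : interior F 0).

Lemma interior0_absorbing x : exists2 a, 0 < a & F (a *: x).
Proof.
have /nbhs_normP[e /= e0 eF] := F0.
have x1 : 0 < `|x| + 1 by rewrite ltr_wpDl.
exists (e / 2 / (`|x| + 1)); first by rewrite !divr_gt0.
apply: eF; rewrite /ball_/= sub0r normrN normrZ gtr0_norm ?divr_gt0//.
rewrite mulrAC ltr_pdivrMr//.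
have := normr_ge0 x; nra.
Qed.

(** [F] contains a max-norm ball of radius [e], hence the multiple of [y] of Euclidean length
    [e / 2]; testing [y] against it gives [e * enorm y / 2 <= 1]. *)
Lemma polar_bounded : exists M, forall y, polar F y -> enorm y <= M.
Proof.
have /nbhs_normP[e /= e0 eF] := F0.
exists (2 / e) => y Fy; have [->|y0] := eqVneq y 0.
  by rewrite enorm0 divr_ge0// ltW.
have ey0 : 0 < enorm y.
  rewrite lt_neqAle enorm_ge0 andbT eq_sym.
  by apply: contra y0 => /eqP/enorm_eq0 ->.
have : F ((e / 2 / enorm y) *: y).
  apply: eF; rewrite /ball_/= sub0r normrN normrZ gtr0_norm ?divr_gt0//.
  rewrite mulrAC ltr_pdivrMr//.
  have := mx_norm_le_enorm y; nra.
move=> /Fy; rewrite dotZr -sqr_enorm.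
have -> : e / 2 / enorm y * enorm y ^+ 2 = e * enorm y / 2.
  by field; rewrite gt_eqF.
by move=> h; rewrite ler_pdivlMr//; lra.
Qed.

Lemma enorm_le_set_enorm y : polar F y -> enorm y <= set_enorm (polar F).
Proof.
have [M MP] := polar_bounded.
move=> Fy; apply: sup_upper_bound; last by exists y.
split; first by exists (enorm y); exists y.
by exists M => _ [z Fz <-]; exact: MP.
Qed.

Lemma set_enorm_polar_ge0 : 0 <= set_enorm (polar F).
Proof.
rewrite -(@enorm0 R d); apply: enorm_le_set_enorm => x _.
by rewrite -(scale0r 0) dotZl mul0r.
Qed.

(** Let [p] be a nearest point of [F] to [u]. If [z = u - p] were nonzero, a positive multiple of
    [z] would lie in the polar set and separate [u] from [F]. *)
Lemma bipolar u : (forall y, polar F y -> dot y u <= 1) -> F u.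
Proof.
move=> Fu.
have [|p] := EVT_min_rV _ Fcompact (continuous_subspaceT (enormB_continuous (z := u))).
  by exists 0; exact: nbhs_singleton.
rewrite inE => Fp pmin; set z := u - p.
have [z0|z0] := eqVneq z 0; first by rewrite (subr0_eq z0).
(* Variational inequality of the projection: otherwise a small move from [p] towards [x] comes
   closer to [u]. *)
have zF x : F x -> dot z (x - p) <= 0.
  move=> Fx; rewrite leNgt; apply/negP; set w := x - p => zw0.
  have ww0 := dot_ge0 w.
  (* This step length lies in (0, 1] and satisfies [l * dot w w < dot z w], so that [z - l *: w] is
     shorter than [z]. *)
  pose l := dot z w / (dot z w + dot w w).
  have l0 : 0 < l by rewrite divr_gt0// ltr_wpDr.
  have l1 : l <= 1 by rewrite ler_pdivrMr ?ltr_wpDr// mul1r lerDl.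
  have lE : l * (dot z w + dot w w) = dot z w by rewrite divfK// gt_eqF// ltr_wpDr.
  have := pmin (l *: x + (1 - l) *: p).
  rewrite inE => /(_ (mem_convex Fconvex Fx Fp (ltW l0) l1)).
  have -> : l *: x + (1 - l) *: p - u = - (z - l *: w).
    by rewrite /z /w scalerBl scale1r scalerBr; apply/rowP => i; rewrite !mxE; ring.
  rewrite -[p - u]opprB -/z !enormN ler_sqrt ?dot_ge0//.
  rewrite dotBZ; nra.
have zz0 := dot_gt0 z0.
(* Since [a *: z] lies in [F], the inequality [zF] gives [0 < a * dot z z <= dot z p], so [z] can be
   normalized by [dot z p]. *)
have [a a0 Fa] := interior0_absorbing z.
have zp0 : 0 < dot z p.
  have := zF _ Fa; rewrite dotDr dotNr dotZr subr_le0; apply: lt_le_trans.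
  exact: mulr_gt0.
have /Fu : polar F ((dot z p)^-1 *: z).
  move=> x Fx; rewrite dotZl ler_pdivrMl// mulr1 -subr_le0 -dotNr -dotDr.
  exact: zF.
have zu : dot z u = dot z z + dot z p by rewrite -dotDr subrK.
by rewrite dotZl ler_pdivrMl// mulr1 zu gerDr leNgt zz0.
Qed.

Lemma scale_mem_polar_bound s u :
  0 < s -> set_enorm (polar F) * enorm u <= s -> F (s^-1 *: u).
Proof.
move=> s0 us; apply: bipolar => y Fy.
rewrite dotZr ler_pdivrMl// mulr1; apply: le_trans us.
apply: (le_trans (cauchy_schwarz y u)).
by rewrite ler_wpM2r ?enorm_ge0// enorm_le_set_enorm.
Qed.

(** The vector [u] lies in sF by the bipolar theorem; the witness is the convex combination of [f]
    and [s^-1 *: u] with weights t/(t+s) and s/(t+s). *)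
Lemma dilate_add t s f u :
  0 <= t -> 0 < s -> F f -> set_enorm (polar F) * enorm u <= s ->
  exists2 g, F g & t *: f + u = (t + s) *: g.
Proof.
move=> t0 s0 Ff us; have ts0 : 0 < t + s by rewrite ltr_wpDl.
exists (t / (t + s) *: f + (1 - t / (t + s)) *: (s^-1 *: u)).
  apply: mem_convex => //; first exact: scale_mem_polar_bound.
    by rewrite divr_ge0// ltW.
  by rewrite ler_pdivrMr// mul1r lerDl ltW.
rewrite scalerDr !scalerA; congr (_ *: _ + _).
  by rewrite mulrC divfK ?gt_eqF.
rewrite [X in X *: _](_ : _ = 1) ?scale1r//.
by field; rewrite !gt_eqF.
Qed.

(** * The minimal time function and its Lipschitz bounds *)

Lemma min_time_le t f x (W : set 'rV[R]_d) :
  0 <= t -> F f -> W (x + t *: f) -> min_time F x W <= t.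
Proof.
move=> t0 Ff Wf; apply: ge_inf; first by exists 0 => ? [].
by split=> //; exists (x + t *: f); split=> //; exists f.
Qed.

Lemma min_time_adherent e x (W : set 'rV[R]_d) : W !=set0 -> 0 < e ->
  exists t f, [/\ 0 <= t, F f, W (x + t *: f) & t < min_time F x W + e].
Proof.
move=> [w Ww] e0.
have [] := @inf_adherent _
  [set t : R | 0 <= t /\ dilate_at x t F `&` W !=set0] _ e0; last first.
  by move=> t [t0 [_ [[f Ff <-] Wf]]] te; exists t, f.
split; last by exists 0 => ? [].
(* An admissible time for reaching [w]; the summand 1 keeps it positive even when [w = x]. *)
pose s := set_enorm (polar F) * enorm (w - x) + 1.
have s0 : 0 < s.
  by rewrite ltr_wpDl// mulr_ge0 ?enorm_ge0// set_enorm_polar_ge0.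
exists s; split; first exact: ltW.
exists w; split=> //; exists (s^-1 *: (w - x)).
  by apply: scale_mem_polar_bound => //; rewrite lerDl.
by rewrite scalerA divff ?gt_eqF// scale1r addrC subrK.
Qed.

Lemma min_time_ge0 x (W : set 'rV[R]_d) : W !=set0 -> 0 <= min_time F x W.
Proof.
move=> W0; apply/ler_addgt0Pr => e e0.
have [t [f [t0 _ _ te]]] := min_time_adherent x W0 e0.
exact: le_trans (ltW te).
Qed.

(** Only the relative position of target and starting point matters, so one estimate serves both for
    moving the point and for moving the target. *)
Lemma min_time_le_shift x y (W V : set 'rV[R]_d) delta :
  V !=set0 -> 0 <= delta ->
  (forall v e, V v -> 0 < e ->
    exists2 w, W w & enorm ((w - x) - (v - y)) <= delta + e) ->
  min_time F x W <= min_time F y V + set_enorm (polar F) * delta.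
Proof.
move=> V0 delta0 VW; apply/ler_addgt0Pr => e e0.
set L := set_enorm (polar F); have L0 : 0 <= L := set_enorm_polar_ge0.
(* The slack [r] enters once through the near-optimal time [t], [L] times through the distance, and
   once to make the added time positive: [L + 2] in all. *)
pose r := e / (L + 2); have r0 : 0 < r by rewrite divr_gt0// ltr_wpDl.
have rE : r * (L + 2) = e by rewrite divfK// gt_eqF// ltr_wpDl.
have [t [f [t0 Ff Vf tr]]] := min_time_adherent y V0 r0.
have [w Ww] := VW _ _ Vf r0; set u := (w - x) - _ => ur.
have s0 : 0 < L * (delta + r) + r by rewrite ltr_wpDl// mulr_ge0// addr_ge0// ltW.
have [|g Fg gE] := dilate_add t0 s0 Ff (u := u).
  by rewrite (le_trans (ler_wpM2l L0 ur))// lerDl ltW.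
apply: (@le_trans _ _ (t + (L * (delta + r) + r))); last nra.
apply: (min_time_le _ Fg); first by rewrite addr_ge0// ltW.
rewrite -gE (_ : x + _ = w)//.
by rewrite /u; apply/rowP => i; rewrite !mxE; ring.
Qed.

Lemma min_time_lipschitz x y (W : set 'rV[R]_d) : W !=set0 ->
  min_time F x W <= min_time F y W + set_enorm (polar F) * enorm (x - y).
Proof.
move=> W0; apply: min_time_le_shift => //; first exact: enorm_ge0.
move=> v e Wv e0; exists v => //.
by rewrite opprB addrC addrA subrK -enormN opprB lerDl ltW.
Qed.

(** * One-sided Hausdorff distance between targets *)

Lemma excess_has_sup (W V : set 'rV[R]_d) :
  W !=set0 -> compact W -> V !=set0 ->
  has_sup [set inf [set enorm (a - b) | b in V] | a in W].
Proof.
move=> [w Ww] Wc [v Vv]; split; first by eexists; exists w.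
(* The distance to [V] is at most the distance to its single point [v], which is bounded on the
   compact set [W]. *)
have [|M WM] := compact_continuous_bounded _ Wc (enormB_continuous (z := v)).
  by exists w.
exists M => _ [a Wa <-]; apply: le_trans (WM _ Wa); apply: ge_inf; last by exists v.
by exists 0 => _ [b _ <-]; exact: enorm_ge0.
Qed.

Lemma excess_adherent (W V : set 'rV[R]_d) a e :
  compact W -> V !=set0 -> W a -> 0 < e ->
  exists2 b, V b & enorm (b - a) <= excess W V + e.
Proof.
move=> Wc [v Vv] Wa e0.
have [|_ [b Vb <-] be] := @inf_adherent _ [set enorm (a - b) | b in V] _ e0.
  split; first by eexists; exists v.
  by exists 0 => _ [b _ <-]; exact: enorm_ge0.
exists b => //; rewrite -enormN opprB (le_trans (ltW be))// lerD2r.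
apply: sup_upper_bound; last by exists a.
by apply: excess_has_sup => //; [exists a | exists v].
Qed.

Lemma excess_ge0 (W V : set 'rV[R]_d) :
  W !=set0 -> compact W -> V !=set0 -> 0 <= excess W V.
Proof.
move=> [w Ww] Wc V0; apply/ler_addgt0Pr => e e0.
have [b _ be] := excess_adherent Wc V0 Ww e0.
exact: le_trans (enorm_ge0 _) be.
Qed.

Lemma min_time_le_excess x (W V : set 'rV[R]_d) :
  nonempty_compact W -> nonempty_compact V ->
  min_time F x W <= min_time F x V + set_enorm (polar F) * excess V W.
Proof.
move=> [W0 _] [V0 Vc]; apply: min_time_le_shift => //; first exact: excess_ge0.
move=> v e Vv e0; have [w Ww wv] := excess_adherent Vc W0 Vv e0.
by exists w => //; rewrite opprB addrA subrK.
Qed.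

(** * Coercivity, and an optimal location for one facility *)

Lemma min_time_sublevel_bounded (W : set 'rV[R]_d) c : nonempty_compact W ->
  exists r, forall x, min_time F x W <= c -> `|x| <= r.
Proof.
move=> [W0 Wc]; have F00 : F 0 by exact: nbhs_singleton.
have [A WA] := compact_continuous_bounded W0 Wc (@norm_continuous _ _).
have [|B FB] := compact_continuous_bounded _ Fcompact (@norm_continuous _ _).
  by exists 0.
(* A target point [x + t *: f] has norm at most [A], while [t <= c + 1] and [f] has norm at most
   [B]. *)
exists (A + (c + 1) * B) => x xc.
have [t [f [t0 Ff Wf tx]]] := min_time_adherent x W0 (@ltr01 R).
have -> : x = (x + t *: f) - t *: f by rewrite addrK.
apply: (le_trans (ler_normB _ _)); apply: lerD; first exact: WA.
rewrite normrZ ger0_norm//; apply: ler_pM => //; last exact: FB.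
by rewrite (le_trans (ltW tx))// lerD2r.
Qed.

(** [S] stands for the targets assigned to one facility. If it is empty the cost is zero; otherwise
    a single term already makes the continuous cost coercive. *)
Lemma sum_min_time_attained m (W : 'I_m -> set 'rV[R]_d) (S : pred 'I_m) :
  (forall i, nonempty_compact (W i)) ->
  exists x, forall y, \sum_(i | S i) min_time F x (W i) <=
                      \sum_(i | S i) min_time F y (W i).
Proof.
move=> hW; pose g x := \sum_(i | S i) min_time F x (W i).
have [i0 Si0|S0] := pickP S; last first.
  by exists 0 => y; rewrite !big_pred0.
have [r rP] := min_time_sublevel_bounded (g 0) (hW i0).
have gr y : g y <= g 0 -> `|y| <= r.
  move=> yg; apply: rP; apply: le_trans yg; rewrite /g (bigD1 i0)//= lerDl.
  by apply: sumr_ge0 => i _; apply: min_time_ge0; case: (hW i).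
have gcont : continuous g.
  apply: (@enorm_lipschitz_continuous _ _ _ (\sum_(i | S i) set_enorm (polar F))).
  move=> x y; rewrite mulr_suml -big_split; apply: ler_sum => i _.
  by apply: min_time_lipschitz; case: (hW i).
(* Minimizing over this compact ball suffices: it contains 0, and outside it [g] exceeds [g 0]. *)
have [|||x _ xmin] := @EVT_min_rV _ _ g [set y | `|y| <= r].
- by exists 0; apply: gr.
- apply: bounded_closed_compact.
    by exists r; split=> [|s rs y /= yr]; [exact: num_real | exact: le_trans (ltW rs)].
  by apply: (closed_comp _ (@closed_le R r)) => y _; exact: norm_continuous.
- exact: continuous_subspaceT.
exists x => y; have [yr|ry] := leP `|y| r; first by apply: xmin; rewrite inE.
apply: (@le_trans _ _ (g 0)); first by apply: xmin; rewrite inE; apply: gr.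
by apply: ltW; rewrite ltNge; apply/negP => /gr; rewrite leNgt ry.
Qed.

End Gauge.

(** * Existence of optimal facility locations *)

Lemma minimum_range_attained (R : realType) k (g : 'I_k.+1 -> R) :
  exists2 j, minimum (range g) = g j & forall i, g j <= g i.
Proof.
have [j _ jmin] := Order.TotalTheory.arg_minP g (erefl : xpredT (ord0 : 'I_k.+1)).
have gj i : g j <= g i by exact: jmin.
by exists j => //; apply: minimumE; [exists j | move=> _ [i _ <-]].
Qed.

(** Fixing an assignment of targets to facilities decouples the facilities; it then remains to
    choose the best of finitely many assignments. *)
Lemma optimal_value_attained (R : realType) (d : nat) (F : set 'rV[R]_d)
    m k (W : 'I_m -> set 'rV[R]_d) :
  compact F -> @convex_set R 'rV[R]_d F -> interior F 0 ->
  (forall i, nonempty_compact (W i)) ->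
  exists2 x : 'I_k.+1 -> 'rV[R]_d,
    optimal_value F k.+1 W = location_cost F x W &
    forall y : 'I_k.+1 -> 'rV[R]_d, location_cost F x W <= location_cost F y W.
Proof.
move=> Fc Fconv F0 hW.
have Smin (S : pred 'I_m) := sum_min_time_attained Fc Fconv F0 S hW.
(* For the assignment [s], each facility is placed optimally for its own fiber of targets. *)
pose loc (s : {ffun 'I_m -> 'I_k.+1}) (j : 'I_k.+1) :=
  projT1 (cid (Smin [pred i | s i == j])).
pose cost (s : {ffun 'I_m -> 'I_k.+1}) (x : 'I_k.+1 -> 'rV[R]_d) := \sum_i min_time F (x (s i)) (W i).
have costE s x : cost s x = \sum_j \sum_(i | s i == j) min_time F (x j) (W i).
  rewrite /cost (partition_big s xpredT)//=; apply: eq_bigr => j _.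
  by apply: eq_bigr => i /eqP ->.
have locP s x : cost s (loc s) <= cost s x.
  rewrite !costE; apply: ler_sum => j _.
  by rewrite /loc; case: cid => y /=; exact.
have cost_ge s x : location_cost F x W <= cost s x.
  apply: ler_sum => i _.
  have [j -> jmin] := minimum_range_attained (fun j => min_time F (x j) (W i)).
  exact: jmin.
(* Assigning each target to a facility of least minimal time recovers the location cost. *)
have cost_le x : exists s : {ffun 'I_m -> 'I_k.+1}, cost s x <= location_cost F x W.
  pose jmin i := minimum_range_attained (fun j => min_time F (x j) (W i)).
  exists [ffun i => s2val (cid2 (jmin i))].
  apply: ler_sum => i _; rewrite ffunE.
  by case: cid2 => j /= -> _.
have [s _ smin] := Order.TotalTheory.arg_minP (fun s => cost s (loc s))
  (erefl : xpredT [ffun=> ord0]).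
have xmin (y : 'I_k.+1 -> 'rV[R]_d) :
    location_cost F (loc s) W <= location_cost F y W.
  have [r ry] := cost_le y; apply: le_trans ry.
  apply: (le_trans (cost_ge s _)); apply: le_trans (locP r y).
  exact: smin.
by exists (loc s) => //; apply: minimumE; [exists (loc s) | move=> _ [y _ <-]].
Qed.

(** * Lipschitz estimate for the cost and the optimal value *)

Lemma location_cost_le_hausdorff (R : realType) (d : nat) (F : set 'rV[R]_d)
    m k (x : 'I_k.+1 -> 'rV[R]_d) (W V : 'I_m -> set 'rV[R]_d) :
  compact F -> @convex_set R 'rV[R]_d F -> interior F 0 ->
  (forall i, nonempty_compact (W i)) -> (forall i, nonempty_compact (V i)) ->
  location_cost F x W <=
    location_cost F x V + m%:R * set_enorm (polar F) * hausdorff_distn W V.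
Proof.
move=> Fc Fconv F0 hW hV; set D := hausdorff_distn W V.
rewrite -mulrA mulr_natl -[X in _ *+ X]card_ord -sumr_const -big_split.
apply: ler_sum => i _ /=.
have [j -> jmin] := minimum_range_attained (fun j => min_time F (x j) (W i)).
(* Both targets are compared through [l], the facility that is best for [V i]. *)
have [l -> _] := minimum_range_attained (fun j => min_time F (x j) (V i)).
apply: (le_trans (jmin l)).
apply: (le_trans (min_time_le_excess Fc Fconv F0 (x l) (hW i) (hV i))).
rewrite lerD2l ler_wpM2l ?set_enorm_polar_ge0//.
apply: (@le_trans _ _ (hausdorff_dist (W i) (V i))).
  by rewrite le_max lexx orbT.
exact: (le_bigmax _ (fun i => hausdorff_dist (W i) (V i))).
Qed.

Lemma hausdorff_distnC (R : realType) (d m : nat) (W V : 'I_m -> set 'rV[R]_d) :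
  hausdorff_distn W V = hausdorff_distn V W.
Proof. by apply: eq_bigr => i _; rewrite /hausdorff_dist maxC. Qed.

Theorem theorem5p5 (R : realType) (d : nat) (hd : (1 <= d)%N)
    (F : set 'rV[R]_d) (Fcompact : compact F)
    (Fconvex : @convex_set R 'rV[R]_d F) (F0 : interior F 0)
    (m k : nat) (hm : (2 <= m)%N) (hk : (1 <= k <= m)%N)
    (W V : 'I_m -> set 'rV[R]_d)
    (hW : forall i, nonempty_compact (W i))
    (hV : forall i, nonempty_compact (V i)) :
  `|optimal_value F k W - optimal_value F k V|
    <= m%:R * set_enorm (polar F) * hausdorff_distn W V.
Proof.
(* With at least one facility, the inner minima range over a nonempty set and are attained. *)
case: k hk => [|k _]; first by [].
have [x -> xmin] := optimal_value_attained k Fcompact Fconvex F0 hW.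
have [y -> ymin] := optimal_value_attained k Fcompact Fconvex F0 hV.
(* Each half evaluates the cost for one family at the minimizer for the other. *)
rewrite ler_distlC; apply/andP; split.
  rewrite lerBlDr; apply: (le_trans (xmin y)).
  exact: location_cost_le_hausdorff.
apply: (le_trans (ymin x)); rewrite hausdorff_distnC.
exact: location_cost_le_hausdorff.
Qed.
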